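(* Let $f$ be a Bernstein function with Lévy--Khintchine representation $f(z)=a+bz+\int_0^\infty(1-e^{-tz})\,\mathrm{d}\mu(t)$, let $A\in\mathbb{C}^{n\times n}$ be Hermitian positive semidefinite with spectral radius $\rho(A)$, and denote by $d(i,j)$ the geodesic distance of the nodes $i$ and $j$ in the graph of $A$. Then for all $i,j$ with $d(i,j)\ge 2$, $$ \begin{aligned} |[f(A)]_{ij}| \le{}& 10\int_0^{\frac{2d(i,j)}{\rho(A)}} \frac{4\exp\left(-\frac14\rho(A)t\right)}{\rho(A)\,t}\left(\frac{e\,\rho(A)\,t}{4\,d(i,j)}\right)^{d(i,j)}\mathrm{d}\mu(t)\\ &+10\int_{\frac{2d(i,j)}{\rho(A)}}^{\frac{d(i,j)^2}{\rho(A)}}\exp\left(-\frac{4\,d(i,j)^2}{5\,\rho(A)\,t}\right)\mathrm{d}\mu(t) +\int_{\frac{d(i,j)^2}{\rho(A)}}^\infty \left|[\exp(-tA)]_{ij}\right|\mathrm{d}\mu(t). \end{aligned} $$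
   Context: A Bernstein function is a nonnegative, infinitely differentiable function $f:(0,\infty)\to\mathbb{R}$ with $(-1)^{n-1}f^{(n)}(z)\ge 0$ for all $n\in\mathbb{N}=\{1,2,\dots\}$ and $z>0$. Every Bernstein function has a Lévy--Khintchine representation $f(z)=a+bz+\int_0^\infty(1-e^{-tz})\,\mathrm{d}\mu(t)$ with $a,b\ge 0$ and $\mu$ a positive measure on $(0,\infty)$ satisfying $\int_0^\infty\min\{t,1\}\,\mathrm{d}\mu(t)<\infty$; it extends continuously to $z=0$ (the extension is also denoted $f$) and the representation remains valid there. For Hermitian $A=V\Lambda V^H$ with $V$ unitary and $\Lambda=\operatorname{diag}(\lambda_1,\dots,\lambda_n)$, set $f(A)=V\operatorname{diag}(f(\lambda_1),\dots,f(\lambda_n))V^H$. The graph of $A=(a_{ij})$ has nodes $1,\dots,n$ and edges $\{(i,j): a_{ij}\ne 0,\ i\ne j\}$. The geodesic distance $d(i,j)$ is the length of a shortest path from $i$ to $j$ in this graph, with $d(i,j)=\infty$ if no path exists. *)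

(* Defs.v *)
From HB Require Import structures.
From mathcomp Require Import all_boot all_order all_algebra.
From mathcomp Require Import complex.
From mathcomp Require Import all_classical all_reals all_analysis.

Set Implicit Arguments.
Unset Strict Implicit.
Unset Printing Implicit Defensive.

Import Order.TTheory GRing.Theory Num.Theory.
Import numFieldNormedType.Exports.

Local Open Scope classical_set_scope.
Local Open Scope ring_scope.
Local Open Scope complex_scope.
Local Open Scope sesquilinear_scope.

(* Only the values of f on ]0, +oo[ are constrained. *)
Definition bernstein (R : realType) (f : R -> R) : Prop :=
  [/\ forall z : R, 0 < z -> 0 <= f z,
      forall (n : nat) (z : R), 0 < z -> derivable (derive1n n f) z 1
    & forall (n : nat) (z : R), (0 < n)%N -> 0 < z ->
        0 <= (-1) ^+ n.-1 * derive1n n f z].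

(* mu is a measure on the whole line, but it is only ever integrated over
   subsets of ]0, +oo[, so that it stands for its restriction to ]0, +oo[. *)
Definition levy_khintchine (R : realType) (f : R -> R) (a b : R)
    (mu : {measure set (measurableTypeR R) -> \bar R}) : Prop :=
  [/\ 0 <= a, 0 <= b,
      (\int[mu]_(t in `]0%R, +oo[) (Num.min t 1)%:E < +oo)%E
    & forall z : R, 0 < z ->
        ((f z)%:E = (a + b * z)%:E
                    + \int[mu]_(t in `]0%R, +oo[) (1 - expR (- (t * z)))%:E)%E].

Definition psdmx (R : realType) (n : nat) (A : 'M[R[i]]_n) : Prop :=
  A \is hermsymmx /\ forall x : 'cV[R[i]]_n, 0 <= (x^t* *m A *m x) 0 0.

Definition spectral_radius (R : realType) (n : nat) (A : 'M[R[i]]_n) : R :=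
  sup [set Normc.normc l | l in [set l : R[i] | eigenvalue A l]].

(* f(A) for Hermitian A. MathComp's diagonalisation reads
   A = P^-1 *m diag_mx D *m P with P := spectralmx A unitary; V is P^t* here.
   The eigenvalues D are real, so that taking their real parts loses nothing. *)
Definition hermfun (R : realType) (n : nat) (f : R -> R) (A : 'M[R[i]]_n) :
    'M[R[i]]_n :=
  (spectralmx A)^t*
    *m diag_mx (map_mx (fun l : R[i] => (f (complex.Re l))%:C) (spectral_diag A))
    *m spectralmx A.

(* f(A) does not depend on the diagonalisation. *)
Lemma hermfunE (R : realType) (n : nat) (f : R -> R) (A V : 'M[R[i]]_n)
    (L : 'rV[R]_n) :
  V \is unitarymx -> A = V *m diag_mx (map_mx (real_complex R) L) *m V^t* ->
  hermfun f A = V *m diag_mx (map_mx (fun l => (f l)%:C) L) *m V^t*.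
Proof.
move=> Vu AE; pose P := spectralmx A; pose D := spectral_diag A.
pose LC := map_mx (real_complex R) L.
have Pu : P \is unitarymx := spectral_unitarymx A.
have VtV : V^t* *m V = 1%:M by rewrite -invmx_unitary// mulVmx// unitarymx_unit.
have PtP : P^t* *m P = 1%:M by rewrite -invmx_unitary// mulVmx// unitarymx_unit.
have DE : A = P^t* *m diag_mx D *m P.
  rewrite -invmx_unitary//; apply/orthomx_spectralP.
  apply/orthomx_spectral_subproof; exists (V^t*, LC) => /=.
    by rewrite trmxC_unitary.
  by rewrite invmx_unitary ?trmxC_unitary// trmxCK.
have PVE : diag_mx D *m (P *m V) = (P *m V) *m diag_mx LC.
  have : P *m A *m V = P *m A *m V by [].
  rewrite {1}DE {1}AE !mulmxA (unitarymxP Pu) mul1mx => ->.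
  by rewrite -!mulmxA VtV mulmx1.
pose g (h : R -> R) (l : R[i]) := (h (complex.Re l))%:C.
have gPV : diag_mx (map_mx (g f) D) *m (P *m V)
    = (P *m V) *m diag_mx (map_mx (fun l => (f l)%:C) L).
  move: (P *m V) PVE => M PVE.
  apply/matrixP => k l; move/matrixP/(_ k l): PVE.
  rewrite !mul_diag_mx !mul_mx_diag !mxE => DkL.
  have [->|M0] := eqVneq (M k l) 0; first by rewrite mulr0 mul0r.
  move: DkL; rewrite [RHS]mulrC => /(mulIf M0) ->.
  by rewrite mulrC.
rewrite /hermfun -/P -/D -/(g f).
have := congr1 (fun M => P^t* *m M *m V^t*) gPV.
rewrite -!mulmxA (unitarymxP Vu) mulmx1 => ->.
by rewrite !mulmxA PtP mul1mx.
Qed.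

Definition graph_adj (R : realType) (n : nat) (A : 'M[R[i]]_n) : rel 'I_n :=
  [rel i j | (i != j) && (A i j != 0)].

Definition has_walk (R : realType) (n : nat) (A : 'M[R[i]]_n) (i j : 'I_n)
    (k : nat) : bool :=
  [exists p : k.-tuple 'I_n, path (graph_adj A) i p && (last i p == j)].

(* None stands for an infinite distance. *)
Definition geodist (R : realType) (n : nat) (A : 'M[R[i]]_n) (i j : 'I_n) :
    option nat :=
  if pselect (exists k, has_walk A i j k) is left walk_ij
  then Some (ex_minn walk_ij) else None.

(* Main.v *)
(* For fixed i, j the map f |-> f(A)_ij = \sum_l conj(P_li) P_lj f(lam_l) is a
   linear functional with \sum_l |P_li| |P_lj| <= 1 which vanishes on polynomials
   of degree < d(i,j). Rotating by a phase that makes f(A)_ij real nonnegative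
   leaves a real functional r with the same two properties, and the
   Levy-Khintchine formula gives |f(A)_ij| <= \int |\sum_l r_l exp(-t lam_l)| dmu.

   In place of Bessel functions and the truncated Chebyshev series, the entries
   of the exponential are bounded by a Chernoff argument. Put
   y = 2 lam / rho - 1 and let T_k be the Chebyshev polynomials. Since
   y T_k = (T_(k+1) + T_(k-1)) / 2, |r(T_k)| <= 1 and r(T_k) = 0 for k < d,
   induction on m gives, for every w >= 1,
     |r(y^m T_k)| <= w^-d (w^k + w^-k) C^m,   C = (w + 1/w) / 2.
   Summing the exponential series,
     |r(exp(-t lam))| <= 2 w^-d exp(rho t / 2 (C - 1)).
   For t <= 2d/rho take w = 4d/(rho t); for t > 2d/rho take
   w = exp(8d/(5 rho t)). *)

Require Import Defs.
From HB Require Import structures.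
From mathcomp Require Import all_boot all_order all_algebra.
From mathcomp Require Import complex.
From mathcomp Require Import all_classical all_reals all_analysis.
From mathcomp Require Import measurable_realfun ring lra zify.

Set Implicit Arguments.
Unset Strict Implicit.
Unset Printing Implicit Defensive.

Import Order.TTheory GRing.Theory Num.Theory.
Import numFieldNormedType.Exports.

Local Open Scope classical_set_scope.
Local Open Scope ring_scope.
Local Open Scope complex_scope.

(** * Decay of linear functionals that vanish on polynomials of degree below d *)

(* [cos (k * acos y)] is the Chebyshev polynomial T_k at y. *)
Lemma sum_cos_pow_bound (R : realType) (n d : nat) (r y : 'I_n -> R) (w : R) :
  1 <= w -> \sum_l `|r l| <= 1 -> (forall l, -1 <= y l <= 1) ->
  (forall m, (m < d)%N -> \sum_l r l * y l ^+ m = 0) ->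
  forall m k : nat, `|\sum_l r l * (y l ^+ m * cos (k%:R * acos (y l)))| <=
    w ^- d * (w ^+ k + w ^- k) * ((w + w^-1) / 2) ^+ m.
Proof.
move=> w1 r1 yB ry0.
have w0 : 0 < w by rewrite (lt_le_trans _ w1).
have wne : w != 0 by rewrite gt_eqF.
pose c k l := cos (k%:R * acos (y l)).
have c0 l : c 0%N l = 1 by rewrite /c mul0r cos0.
have c1 l : c 1%N l = y l by rewrite /c mul1r acosK// in_itv/= yB.
have cS k l : c k.+2 l = 2 * y l * c k.+1 l - c k l.
  have ca : cos (acos (y l)) = y l by rewrite acosK// in_itv/= yB.
  rewrite /c.
  have -> : k.+2%:R * acos (y l) = k.+1%:R * acos (y l) + acos (y l).
    by rewrite -[k.+2]addn1 natrD mulrDl mul1r.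
  have -> : k%:R * acos (y l) = k.+1%:R * acos (y l) - acos (y l).
    by rewrite -[k.+1]addn1 natrD mulrDl mul1r addrK.
  by rewrite cosD cosB ca; ring.
(* y^m T_k has degree m + k, so [r] kills it below degree d. The three-term recurrence reaches two
   indices back, hence the strong induction on k. *)
have cpow k m : (m + k < d)%N -> \sum_l r l * (y l ^+ m * c k l) = 0.
  have [N kN] := ubnP k; elim: N => // N IHN in k m kN *.
  case: k => [|[|k]] in kN *.
  - rewrite addn0 => md; rewrite -[RHS](ry0 _ md); apply: eq_bigr => l _.
    by rewrite c0 mulr1.
  - rewrite addn1 => md; rewrite -[RHS](ry0 _ md); apply: eq_bigr => l _.
    by rewrite c1 exprSr.
  - move=> md.
    have h1 := IHN k.+1 m.+1 kN; rewrite addSnnS in h1.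
    have h0 := IHN k m (ltn_trans (ltnSn _) kN).
    have -> : \sum_l r l * (y l ^+ m * c k.+2 l) =
        2 * (\sum_l r l * (y l ^+ m.+1 * c k.+1 l)) - \sum_l r l * (y l ^+ m * c k l).
      rewrite mulr_sumr -sumrB; apply: eq_bigr => l _; rewrite cS exprS; ring.
    rewrite h1 ?h0 ?mulr0 ?subr0//; lia.
elim=> [|m IH] k.
  rewrite expr0 mulr1.
  have [kd|dk] := ltnP k d.
    by rewrite cpow// normr0 mulr_ge0// ?addr_ge0// ?invr_ge0 exprn_ge0// ltW.
  (* For k >= d the trivial bound 1 suffices, because w >= 1 gives w^(k-d) >= 1. *)
  apply: (@le_trans _ _ 1).
    apply: le_trans r1; apply: le_trans (ler_norm_sum _ _ _) _.
    apply: ler_sum => l _; rewrite expr0 mul1r normrM ler_piMr//.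
    by rewrite ler_norml cos_geN1 cos_le1.
  rewrite mulrDr; apply: ler_wpDr.
    by rewrite mulr_ge0// ?invr_ge0 exprn_ge0// ltW.
  by rewrite mulrC ler_pdivlMr ?exprn_gt0// mul1r ler_weXn2l.
(* At k = 0 the recurrence degenerates to y T_0 = T_1, and the two bounds agree because 2 C = w +
   1/w. *)
case: k => [|k].
  have -> : \sum_l r l * (y l ^+ m.+1 * c 0%N l) = \sum_l r l * (y l ^+ m * c 1%N l).
    by apply: eq_bigr => l _; rewrite c0 c1 exprSr mulr1.
  apply: le_trans (IH 1%N) _; rewrite le_eqVlt; apply/orP; left; apply/eqP.
  by rewrite !expr0 !expr1 exprS invr1; field; rewrite wne expf_neq0.
(* The bound w^k + w^-k satisfies the recurrence of T_k with y replaced by C: the average of its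
   values at k+2 and k is C times its value at k+1. Both powers are kept so that the induction
   closes with equality. *)
have -> : \sum_l r l * (y l ^+ m.+1 * c k.+1 l) =
    2^-1 * (\sum_l r l * (y l ^+ m * c k.+2 l) + \sum_l r l * (y l ^+ m * c k l)).
  by rewrite -big_split/= mulr_sumr; apply: eq_bigr => l _; rewrite cS exprS; field.
have h2 := IH k.+2; have h0 := IH k.
rewrite normrM ger0_norm ?invr_ge0//.
apply: (@le_trans _ _ (2^-1 * (w ^- d * (w ^+ k.+2 + w ^- k.+2) * ((w + w^-1) / 2) ^+ m
   + w ^- d * (w ^+ k + w ^- k) * ((w + w^-1) / 2) ^+ m))).
  rewrite ler_pM2l ?invr_gt0//; apply: le_trans (ler_normD _ _) _; exact: lerD.
rewrite le_eqVlt; apply/orP; left; apply/eqP.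
rewrite !exprS; field.
by rewrite wne !expf_neq0.
Qed.

(** The moment bounds are inserted term by term into the exponential series; taking absolute values
    turns (-s)^m into s^m, and the majorant sums to an exponential again. The comparison is made on
    partial sums and passed to the limit. *)
Lemma sum_expR_bound (R : realType) (n : nat) (r y : 'I_n -> R) (s K C : R) :
  0 <= s -> 0 <= K -> 0 <= C ->
  (forall m, `|\sum_l r l * y l ^+ m| <= K * C ^+ m) ->
  `|\sum_l r l * expR (- (s * y l))| <= K * expR (s * C).
Proof.
move=> s0 K0 C0 H.
have ecv (x : R) : series (exp_coeff x) N @[N --> \oo] --> expR x.
  exact: is_cvg_series_exp_coeff.
have cvS : (\sum_l r l * series (exp_coeff (- (s * y l))) N) @[N --> \oo]
    --> \sum_l r l * expR (- (s * y l)).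
  apply: cvg_big => [|l _]; first exact: add_continuous.
  by apply: cvgMl_tmp; exact: ecv.
have cvK : K * series (exp_coeff (s * C)) N @[N --> \oo] --> K * expR (s * C).
  by apply: cvgMl_tmp; exact: ecv.
apply: (ler_cvg_to (cvg_norm cvS) cvK).
apply: nearW => N /=.
have -> : \sum_l r l * series (exp_coeff (- (s * y l))) N
    = \sum_(0 <= m < N) ((- s) ^+ m / m`!%:R) * \sum_l r l * y l ^+ m.
  under eq_bigr => l _ do rewrite /series/= mulr_sumr.
  rewrite exchange_big/=; apply: eq_bigr => m _.
  rewrite mulr_sumr; apply: eq_bigr => l _.
  by rewrite /exp_coeff/= -mulNr exprMn; ring.
rewrite /series/= mulr_sumr; apply: le_trans (ler_norm_sum _ _ _) _.
apply: ler_sum => m _; rewrite normrM normf_div normrX normrN (ger0_norm s0).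
rewrite [`|m`!%:R|]ger0_norm//.
apply: le_trans (ler_wpM2l _ (H m)) _.
  by rewrite divr_ge0// exprn_ge0.
rewrite /exp_coeff/= exprMn le_eqVlt; apply/orP; left; apply/eqP; ring.
Qed.

(** The Taylor coefficient 1/2 is relaxed to 5/8, which leaves room for an argument from 1 + u <=
    exp u alone: sinh is bounded at y = x / 8, and cosh (2 z) = 2 (cosh z)^2 - 1 doubles the
    argument back to x. *)
Lemma cosh_le (R : realType) (x : R) : 0 <= x <= 4 / 5 ->
  (expR x + expR (- x)) / 2 <= 1 + 5 / 8 * x ^+ 2.
Proof.
move=> /andP[x0 x1]; pose y := x / 8.
have y0 : 0 <= y by rewrite /y divr_ge0.
have y1 : y <= 1 / 10 by rewrite /y; lra.
pose E := expR y; pose F := expR (- y).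
have EF : E * F = 1 by rewrite -expRD subrr expR0.
have E8 : expR x = E ^+ 8 by rewrite -expRM_natl; congr expR; rewrite /y; field.
have F8 : expR (- x) = F ^+ 8 by rewrite -expRM_natl; congr expR; rewrite /y; field.
have F1 : 1 - y <= F by have := expR_ge1Dx (- y).
have F0 : 0 < F := expR_gt0 _.
have E1 : 1 <= E by have := expR_ge1Dx y; rewrite -/E; lra.
(* E = 1 / F <= 1 / (1 - y), and 1 / (1 - y) <= 1 + 10/9 y as long as y <= 1/10. *)
have E2 : E <= 1 + 10 / 9 * y by nra.
pose q := (E - F) / 2.
have q0 : 0 <= q by rewrite /q; nra.
have q1 : q <= 19 / 18 * y by rewrite /q; lra.
(* a1, a2, a3 are cosh (2 y) - 1, cosh (4 y) - 1 and cosh (8 y) - 1. *)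
pose a1 := 2 * q ^+ 2; pose a2 := 2 * a1 * (2 + a1); pose a3 := 2 * a2 * (2 + a2).
have a1E : (E ^+ 2 + F ^+ 2) / 2 = 1 + a1.
  rewrite /a1 /q.
  have -> : 2 * ((E - F) / 2) ^+ 2 = (E ^+ 2 + F ^+ 2) / 2 - E * F by field.
  by rewrite EF; ring.
have a2E : (E ^+ 4 + F ^+ 4) / 2 = 1 + a2.
  have -> : (E ^+ 4 + F ^+ 4) / 2 = 2 * ((E ^+ 2 + F ^+ 2) / 2) ^+ 2 - (E * F) ^+ 2 by field.
  by rewrite EF a1E /a2; ring.
have a3E : (E ^+ 8 + F ^+ 8) / 2 = 1 + a3.
  have -> : (E ^+ 8 + F ^+ 8) / 2 = 2 * ((E ^+ 4 + F ^+ 4) / 2) ^+ 2 - (E * F) ^+ 4 by field.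
  by rewrite EF a2E /a3; ring.
have yy : y ^+ 2 <= 1 / 100 by rewrite expr2; nra.
have yy0 : 0 <= y ^+ 2 by rewrite sqr_ge0.
have qq : q ^+ 2 <= 361 / 324 * y ^+ 2.
  have -> : 361 / 324 * y ^+ 2 = (19 / 18 * y) ^+ 2 by field.
  by rewrite lerXn2r// nnegrE; lra.
have a10 : 0 <= a1 by rewrite /a1 mulr_ge0// sqr_ge0.
have a1y : a1 <= (9 / 4) * y ^+ 2 by rewrite /a1; lra.
have a2y : a2 <= (37 / 4) * y ^+ 2.
  apply: (@le_trans _ _ (2 * a1 * (41 / 20))); last by lra.
  by rewrite /a2 ler_wpM2l//; lra.
have a20 : 0 <= a2 by rewrite /a2; nra.
(* The target constant is 40 = 64 * 5/8, since x^2 = 64 y^2. *)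
have a3y : a3 <= 40 * y ^+ 2.
  apply: (@le_trans _ _ (2 * a2 * (21 / 10))); last by lra.
  by rewrite /a3 ler_wpM2l//; lra.
rewrite E8 F8 a3E lerD2l; apply: le_trans a3y _.
by rewrite /y le_eqVlt; apply/orP; left; apply/eqP; field.
Qed.

Lemma sum_expR_decay (R : realType) (n d : nat) (r lam : 'I_n -> R) (rho w t : R) :
  0 < rho -> 0 <= t -> 1 <= w -> \sum_l `|r l| <= 1 ->
  (forall l, 0 <= lam l <= rho) ->
  (forall m, (m < d)%N -> \sum_l r l * lam l ^+ m = 0) ->
  `|\sum_l r l * expR (- (t * lam l))| <=
    2 * w ^- d * expR (rho * t / 2 * ((w + w^-1) / 2 - 1)).
Proof.
move=> rho0 t0 w1 r1 lamB rlam0.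
have w0 : 0 < w by rewrite (lt_le_trans _ w1).
pose y l := 2 * lam l / rho - 1.
have yB l : -1 <= y l <= 1.
  rewrite /y; have /andP[l0 l1] := lamB l.
  rewrite -lerBlDr opprK addNr lerBlDr ler_pdivrMr// -[1 + 1]/2%:R ler_pM2l// l1 andbT.
  by rewrite divr_ge0 ?mulr_ge0// ltW.
(* An affine change of variable does not raise degrees, so the vanishing moments carry over from
   [lam] to [y] by the binomial formula. *)
have ry0 m : (m < d)%N -> \sum_l r l * y l ^+ m = 0.
  move=> md; under eq_bigr => l _ do rewrite /y exprDn mulr_sumr.
  rewrite exchange_big/=; apply: big1 => k _.
  have -> : \sum_l r l * ((2 * lam l / rho) ^+ (m - k) * (-1) ^+ k *+ 'C(m, k)) =
    ((2 / rho) ^+ (m - k) * (-1) ^+ k *+ 'C(m, k)) * \sum_l r l * lam l ^+ (m - k).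
    rewrite mulr_sumr; apply: eq_bigr => l _.
    have -> : 2 * lam l / rho = 2 / rho * lam l by rewrite mulrAC.
    by rewrite exprMn !mulrnAl !mulrnAr; congr (_ *+ _); ring.
  by rewrite rlam0 ?mulr0// (leq_ltn_trans (leq_subr _ _)).
have H m : `|\sum_l r l * y l ^+ m| <= 2 * w ^- d * ((w + w^-1) / 2) ^+ m.
  have := sum_cos_pow_bound w1 r1 yB ry0 m 0.
  under eq_bigr => l _ do rewrite mul0r cos0 mulr1.
  by rewrite expr0 invr1 [w ^- d * _]mulrC.
have C0 : 0 <= (w + w^-1) / 2 by rewrite divr_ge0// addr_ge0// ?invr_ge0 ltW.
have K0 : 0 <= 2 * w ^- d by rewrite mulr_ge0// invr_ge0 exprn_ge0// ltW.
have s0 : 0 <= rho * t / 2 by rewrite divr_ge0// mulr_ge0// ltW.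
have := sum_expR_bound s0 K0 C0 H.
(* With s = rho t / 2 one has t lam = s + s y; the factor exp(-s) turns exp(s C) into exp(s (C -
   1)). *)
have -> : \sum_l r l * expR (- (t * lam l)) =
    expR (- (rho * t / 2)) * \sum_l r l * expR (- (rho * t / 2 * y l)).
  rewrite mulr_sumr; apply: eq_bigr => l _; rewrite mulrCA -expRD.
  by congr (_ * expR _); rewrite /y; field; rewrite gt_eqF.
move=> HH; rewrite normrM (ger0_norm (expR_ge0 _)).
apply: le_trans (ler_wpM2l (expR_ge0 _) HH) _.
by rewrite mulrCA -expRD mulrBr mulr1 [- _ + _]addrC.
Qed.

(** With s = rho t / 4 the bound to optimise is w^-d exp(s (w + 1/w) - 2 s). The choice w = d / s
    minimises w^-d exp(s w), and the other term s / w becomes s^2 / d. *)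
Lemma sum_expR_decay_small (R : realType) (n d : nat) (r lam : 'I_n -> R) (rho t : R) :
  0 < t <= 2 * d%:R / rho -> 0 < rho -> \sum_l `|r l| <= 1 ->
  (forall l, 0 <= lam l <= rho) ->
  (forall m, (m < d)%N -> \sum_l r l * lam l ^+ m = 0) ->
  `|\sum_l r l * expR (- (t * lam l))| <=
    10 * (4 * expR (- (1 / 4 * rho * t)) / (rho * t)
            * (expR 1 * rho * t / (4 * d%:R)) ^+ d).
Proof.
move=> /andP[t0 td] rho0 r1 lamB rlam0.
pose s := rho * t / 4.
have s0 : 0 < s by rewrite divr_gt0// mulr_gt0.
have sd : 2 * s <= d%:R by move: td; rewrite ler_pdivlMr// /s; lra.
have d0 : 0 < d%:R :> R by lra.
have w1 : 1 <= d%:R / s by rewrite ler_pdivlMr//; lra.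
apply: le_trans (sum_expR_decay rho0 (ltW t0) w1 r1 lamB rlam0) _.
have -> : expR 1 * rho * t / (4 * d%:R) = expR 1 * (d%:R / s)^-1.
  by rewrite /s; field; rewrite !gt_eqF.
have -> : 4 * expR (- (1 / 4 * rho * t)) / (rho * t) = expR (- s) / s.
  have -> : 1 / 4 * rho * t = s by rewrite /s; field.
  by rewrite /s; field; rewrite !gt_eqF.
rewrite [(expR 1 * _) ^+ _]exprMn -expRM_natl mulr1 -exprVn.
set W := (d%:R / s)^-1 ^+ d.
have W0 : 0 <= W by rewrite exprn_ge0// invr_ge0 (le_trans _ w1).
have -> : rho * t / 2 * ((d%:R / s + (d%:R / s)^-1) / 2 - 1) =
    d%:R - s + (s ^+ 2 / d%:R - s).
  by rewrite /s; field; rewrite !gt_eqF.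
have -> : 10 * (expR (- s) / s * (expR d%:R * W)) = W * expR (d%:R - s) * (10 / s).
  by rewrite expRD; ring.
rewrite expRD.
have -> (u v : R) : 2 * W * (u * v) = W * u * (2 * v) by ring.
apply: ler_wpM2l; first by rewrite mulr_ge0 ?expR_ge0.
(* Since 2 s <= d, s^2 / d is at most s / 2. What remains is 2 s exp(-s/2) <= 10, which follows from
   1 + s/2 <= exp(s/2). *)
apply: (@le_trans _ _ (2 * expR (- (s / 2)))).
  rewrite ler_pM2l// ler_expR.
  have : s ^+ 2 / d%:R <= s / 2 by rewrite ler_pdivrMr//; nra.
  lra.
rewrite ler_pdivlMr// expRN -mulrA [_^-1 * s]mulrC mulrA ler_pdivrMr ?expR_gt0//.
by have := expR_ge1Dx (s / 2); lra.
Qed.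

(** With w = exp x and s = rho t / 2 the exponent is -d x + s (cosh x - 1) <= -d x + 5/8 s x^2. This
    quadratic is least at x = 4/5 d/s, with value -2/5 d^2/s. The range of t gives d < s, hence x <=
    4/5 as [cosh_le] requires. *)
Lemma sum_expR_decay_mid (R : realType) (n d : nat) (r lam : 'I_n -> R) (rho t : R) :
  2 * d%:R / rho < t -> 0 < rho -> \sum_l `|r l| <= 1 ->
  (forall l, 0 <= lam l <= rho) ->
  (forall m, (m < d)%N -> \sum_l r l * lam l ^+ m = 0) ->
  `|\sum_l r l * expR (- (t * lam l))| <=
    10 * expR (- (4 * d%:R ^+ 2 / (5 * rho * t))).
Proof.
move=> td rho0 r1 lamB rlam0.
have t0 : 0 < t by rewrite (le_lt_trans _ td)// divr_ge0 ?mulr_ge0// ltW.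
pose s := rho * t / 2.
have s0 : 0 < s by rewrite divr_gt0// mulr_gt0.
have sd : d%:R < s by move: td; rewrite ltr_pdivrMr// /s; lra.
pose q := d%:R / s.
have q0 : 0 <= q by rewrite divr_ge0// ltW.
have q1 : q <= 1 by rewrite ler_pdivrMr// mul1r ltW.
pose x := 4 / 5 * q.
have xB : 0 <= x <= 4 / 5 by rewrite /x; lra.
have w1 : 1 <= expR x by have := expR_ge1Dx x; lra.
apply: le_trans (sum_expR_decay rho0 (ltW t0) w1 r1 lamB rlam0) _.
rewrite -expRM_natl -expRN -mulrA -expRD.
apply: ler_pM; rewrite ?expR_ge0//; first by lra.
rewrite ler_expR -/s.
have := cosh_le xB; rewrite expRN => h.
apply: (@le_trans _ _ (- (d%:R * x) + s * (5 / 8 * x ^+ 2))).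
  by rewrite lerD2l; apply: ler_wpM2l; [exact: ltW|rewrite lerBlDl].
rewrite /x /q /s le_eqVlt; apply/orP; left; apply/eqP; field.
by rewrite !gt_eqF.
Qed.

(** * From the Lévy-Khintchine representation to an integral of exponentials *)

Lemma measurable_expR_scale (R : realType) (D : set (measurableTypeR R)) (z : R) :
  measurable_fun D (fun t : measurableTypeR R => expR (- (t * z))).
Proof.
apply: measurableT_comp; first exact: measurable_expR.
by apply: measurableT_comp => //; exact: measurable_funM.
Qed.

Lemma measurable_one_sub_expR (R : realType) (D : set (measurableTypeR R)) (z : R) :
  measurable_fun D (fun t : measurableTypeR R => (1 - expR (- (t * z)))%:E).
Proof.
apply/measurable_EFinP/measurable_funB => //; exact: measurable_expR_scale.
Qed.

Lemma one_sub_expR_ge0 (R : realType) (t z : R) : 0 <= t -> 0 <= z ->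
  0 <= 1 - expR (- (t * z)).
Proof. by move=> t0 z0; rewrite subr_ge0 -expR0 ler_expR oppr_le0 mulr_ge0. Qed.

Section levy_khintchine.
Context (R : realType) (f : R -> R) (a b : R).
Context (mu : {measure set (measurableTypeR R) -> \bar R}).
Context (f_levy : levy_khintchine f a b mu).
Let D : set (measurableTypeR R) := `]0%R, +oo[.

Let mD : measurable D. Proof. exact: measurable_itv. Qed.

Lemma levy_integrable (z : R) : 0 <= z ->
  mu.-integrable D (fun t => (1 - expR (- (t * z)))%:E).
Proof.
case: f_levy => _ _ _ H; rewrite le_eqVlt => /predU1P[<-|z0].
  have -> : (fun t : R => (1 - expR (- (t * 0)))%:E) = cst 0%E.
    by apply/funext => t /=; rewrite mulr0 oppr0 expR0 subrr.
  exact: integrable0.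
have D0 t : D t -> 0 <= t by rewrite /D/= in_itv/= andbT => /ltW.
apply/integrableP; split; first exact: measurable_one_sub_expR.
under eq_integral => t tD.
  rewrite gee0_abs; first by over.
  by rewrite lee_fin; apply: one_sub_expR_ge0; [exact/D0/set_mem|exact: ltW].
(* Finiteness is read off the representation: its left-hand side f(z) is a real number. *)
rewrite ltey_eq; apply/orP; left.
have := H _ z0; case: (\int[mu]_(t in D) _)%E => //=.
Qed.

Context (f_ext0 : f z @[z --> 0^'+] --> f 0).

(** A semidefinite matrix may have the eigenvalue 0, whereas [levy_khintchine] speaks of z > 0 only.
    The value at 0 is reached along z_k = 1/(k+1) by dominated convergence, with 1 - exp(-t) as the
    dominating function. *)
Lemma levy_at0 : f 0 = a.
Proof.
have [_ _ _ H] := f_levy.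
pose z k : R := harmonic k.
have z0 k : 0 < z k by rewrite /z /= invr_gt0.
have z1 k : z k <= 1 by rewrite /z /= invf_le1// ler1n.
have zcv : z k @[k --> \oo] --> 0 by exact: cvg_harmonic.
have D0 t : D t -> 0 <= t by rewrite /D/= in_itv/= andbT => /ltW.
have fcv : f (z k) @[k --> \oo] --> f 0.
  by move/cvg_at_rightP: f_ext0; apply; split => // k.
have Icv : (\int[mu]_(t in D) (1 - expR (- (t * z k)))%:E)%E @[k --> \oo] --> 0%E.
  have -> : 0%E = (\int[mu]_(t in D) (cst 0%E : R -> \bar R) t)%E by rewrite integral0.
  apply: (@dominated_cvg _ _ _ mu D mD
    (fun k t => (1 - expR (- (t * z k)))%:E)
    (cst 0%E) (fun t => (1 - expR (- (t * 1)))%:E)).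
  - by move=> k; exact: measurable_one_sub_expR.
  - move=> t Dt /=; apply: cvg_EFin; first exact: nearW.
    have -> : 0 = 1 - expR (- (t * 0)) by rewrite mulr0 oppr0 expR0 subrr.
    apply: cvgB; first exact: cvg_cst.
    apply: continuous_cvg; first exact: continuous_expR.
    by apply: cvgN; apply: cvgMl_tmp.
  - by [].
  - exact: levy_integrable.
  - move=> k t Dt /=.
    have zk := ltW (z0 k).
    rewrite lee_fin ger0_norm; last by apply: one_sub_expR_ge0 => //; exact: D0.
    by rewrite lerD2l lerN2 ler_expR lerN2 ler_wpM2l// D0.
have fE k : f (z k) = a + b * z k + fine (\int[mu]_(t in D) (1 - expR (- (t * z k)))%:E)%E.
  have := H _ (z0 k); have := integrable_fin_num mD (levy_integrable (ltW (z0 k))).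
  by case: (\int[mu]_(t in D) _)%E => //= v _ [].
have fcv2 : f (z k) @[k --> \oo] --> a + b * 0 + fine (0%E : \bar R).
  under eq_fun => k do rewrite fE.
  apply: cvgD; last exact: fine_cvg.
  by apply: cvgD; [exact: cvg_cst|exact: cvgMl_tmp].
by rewrite mulr0 !addr0 in fcv2; exact: (cvg_unique _ fcv fcv2).
Qed.

Lemma levy_ge0 (z : R) : 0 <= z ->
  f z = a + b * z + fine (\int[mu]_(t in D) (1 - expR (- (t * z)))%:E)%E.
Proof.
rewrite le_eqVlt => /predU1P[<-|z0].
  under eq_integral => t do rewrite mulr0 oppr0 expR0 subrr.
  by rewrite integral0 mulr0 !addr0 levy_at0.
have [_ _ _ /(_ _ z0)] := f_levy.
have := integrable_fin_num mD (levy_integrable (ltW z0)).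
by rewrite -/D; case: (\int[mu]_(t in D) _)%E => //= v _ [].
Qed.

(** The vanishing moments of order 0 and 1 remove a + b z, and the one of order 0 also removes the
    constant in 1 - exp(-t z); this is where d >= 2 enters. That constant is dropped only under the
    integral sign, after summation, because [mu] may have infinite mass near 0 and the single
    exponentials need not be integrable. *)
Lemma levy_sum_le (n : nat) (r lam : 'I_n -> R) :
  (forall l, 0 <= lam l) -> \sum_l r l = 0 -> \sum_l r l * lam l = 0 ->
  ((\sum_l r l * f (lam l))%:E <=
    \int[mu]_(t in D) `|\sum_l r l * expR (- (t * lam l))|%:E)%E.
Proof.
move=> lam0 r0 r1.
pose phi l t : \bar R := (1 - expR (- (t * lam l)))%:E.
have iphi l : mu.-integrable D (phi l) by exact: levy_integrable.
have -> : (\sum_l r l * f (lam l))%:E = (\int[mu]_(t in D) (\sum_l (r l)%:E * phi l t))%E.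
  rewrite integral_sum//; last by move=> l; apply: integrableZl.
  transitivity (\sum_l r l * fine (\int[mu]_(t in D) phi l t)%E)%:E.
    congr EFin; transitivity (\sum_l (r l * a + (b * (r l * lam l) +
        r l * fine (\int[mu]_(t in D) phi l t)%E))).
      by apply: eq_bigr => l _; rewrite levy_ge0//; ring.
    by rewrite !big_split/= -mulr_suml -mulr_sumr r0 r1 mul0r mulr0 !add0r.
  rewrite -sumEFin; apply: eq_bigr => l _.
  by rewrite integralZl// EFinM fineK// integrable_fin_num.
apply: le_trans (lee_abs _) _.
apply: le_trans (le_abse_integral _ mD _) _.
  by apply: emeasurable_sum => l; exact: measurable_int (integrableZl mD _ (iphi l)).
rewrite le_eqVlt; apply/orP; left; apply/eqP; apply: eq_integral => t _.
have -> : (\sum_l (r l)%:E * phi l t)%E = (\sum_l r l * (1 - expR (- (t * lam l))))%:E.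
  by rewrite -sumEFin; apply: eq_bigr => l _; rewrite EFinM.
rewrite abse_EFin; congr (_%:E).
under eq_bigr => l _ do rewrite mulrBr mulr1.
by rewrite sumrB r0 sub0r normrN.
Qed.

End levy_khintchine.

(** * Entries of functions of a Hermitian matrix, its spectrum and its graph *)

Section hermitian_entries.
Local Open Scope sesquilinear_scope.

Lemma hermsymmx_spectralE (R : realType) (n : nat) (A : 'M[R[i]]_n) (P := spectralmx A) :
  A \is hermsymmx ->
  A = P^t* *m diag_mx (map_mx (real_complex R)
        (\row_l complex.Re (spectral_diag A 0 l))) *m P.
Proof.
move=> Ah.
have Pu : P \is unitarymx := spectral_unitarymx A.
have DE : A = P^t* *m diag_mx (spectral_diag A) *m P.
  by rewrite -invmx_unitary//; apply/orthomx_spectralP; exact: hermitian_normalmx.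
have dE : map_mx (real_complex R) (\row_l complex.Re (spectral_diag A 0 l)) =
    spectral_diag A.
  apply/rowP => l; rewrite !mxE.
  have /mxOverP/(_ 0 l) := hermitian_spectral_diag_real Ah.
  by move=> /complex_realP[x ->].
by rewrite dE.
Qed.

Context (R : realType) (n : nat) (A : 'M[R[i]]_n).
Let P := spectralmx A.
Let lam l : R := complex.Re (spectral_diag A 0 l).
Let Pu : P \is unitarymx := spectral_unitarymx A.
Let PtP : P^t* *m P = 1%:M.
Proof. by rewrite -invmx_unitary// mulVmx// unitarymx_unit. Qed.

Lemma Re_hermfun (u : R[i]) (h : R -> R) (i j : 'I_n) :
  complex.Re (u * hermfun h A i j) =
  \sum_l complex.Re (u * ((P l i)^* * P l j)) * h (lam l).
Proof.
rewrite /hermfun mul_mx_diag !mxE mulr_sumr raddf_sum; apply: eq_bigr => l _ /=.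
rewrite !mxE -/P -/(lam l).
have -> : u * ((P l i)^* * (h (lam l))%:C * P l j) =
  u * ((P l i)^* * P l j) * (h (lam l))%:C by ring.
by case: (u * _) => x y /=; rewrite mulr0 subr0.
Qed.

Lemma normc_unit_col (i : 'I_n) : \sum_l Normc.normc (P l i) ^+ 2 = 1.
Proof.
have /matrixP/(_ i i) := PtP; rewrite !mxE eqxx => PtPii.
apply: (@complexI R); rewrite -[RHS]PtPii rmorph_sum; apply: eq_bigr => l _.
by rewrite !mxE rmorphXn/= -[LHS]/(`|P l i| ^+ 2) sqr_normc mulrC.
Qed.

(** The phase u is chosen for [f], so that u f(A)_ij is its own modulus. The resulting real weights
    serve every other h with an inequality, as |Re z| <= |z|. *)
Lemma hermfun_entry_combination (f : R -> R) (i j : 'I_n) :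
  exists r : 'I_n -> R, [/\ \sum_l `|r l| <= 1,
    Normc.normc (hermfun f A i j) = \sum_l r l * f (lam l)
  & forall h, `|\sum_l r l * h (lam l)| <= Normc.normc (hermfun h A i j)].
Proof.
have ReB (z : R[i]) : `|complex.Re z| <= Normc.normc z.
  by case: z => x y /=; rewrite -sqrtr_sqr ler_wsqrtr// lerDl sqr_ge0.
have [u [u1 uH]] : exists u : R[i], Normc.normc u = 1 /\
    u * hermfun f A i j = (Normc.normc (hermfun f A i j))%:C.
  set z := hermfun f A i j.
  have [->|z0] := eqVneq z 0.
    by exists 1; rewrite Normc.normc1 mulr0 Normc.normc0.
  have nz0 : Normc.normc z != 0 by apply: contra_neq z0; exact: Normc.eq0_normc.
  exists ((Normc.normc z)%:C / z); rewrite divfK//; split => //.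
  rewrite Normc.normcM Normc.normcV.
  suff -> : Normc.normc (Normc.normc z)%:C = Normc.normc z by rewrite divff.
  rewrite /= expr0n addr0 sqrtr_sqr ger0_norm//.
  by case: (z) => x y; exact: sqrtr_ge0.
exists (fun l => complex.Re (u * ((P l i)^* * P l j))); split.
(* |P_li| |P_lj| is at most the mean of the squares, and columns i and j of the unitary P have norm
   1. *)
- apply: (@le_trans _ _ (\sum_l (Normc.normc (P l i) ^+ 2 + Normc.normc (P l j) ^+ 2) / 2)).
    apply: ler_sum => l _; apply: le_trans (ReB _) _.
    rewrite !Normc.normcM u1 mul1r.
    have -> : Normc.normc (P l i)^* = Normc.normc (P l i).
      by case: (P l i) => x y /=; rewrite sqrrN.
    have := sqr_ge0 (Normc.normc (P l i) - Normc.normc (P l j)).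
    rewrite sqrrB; lra.
  by rewrite -mulr_suml big_split/= !normc_unit_col; lra.
- by rewrite -Re_hermfun uH.
- move=> h; rewrite -Re_hermfun; apply: le_trans (ReB _) _.
  by rewrite Normc.normcM u1 mul1r.
Qed.

Context (A_psd : psdmx A).

Let AE : A = P^t* *m diag_mx (map_mx (real_complex R) (\row_l lam l)) *m P.
Proof. by apply: hermsymmx_spectralE; case: A_psd. Qed.

(** The eigenbasis that [hermfun] picks for -tA need not be the one picked for A; independence of
    the diagonalisation brings both sides to the basis of A. This fixed basis also makes the entries
    visibly measurable in t. *)
Lemma hermfun_expR_scale (t : R) :
  hermfun expR ((- t)%:C *: A) = hermfun (fun x => expR (- (t * x))) A.
Proof.
have Vu : P^t* \is unitarymx by rewrite trmxC_unitary.
rewrite (hermfunE expR (L := \row_l (- t * lam l)) Vu).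
  have dE : map_mx (fun l => (expR l)%:C) (\row_l (- t * lam l)) =
      map_mx (fun l : R[i] => (expR (- (t * complex.Re l)))%:C) (spectral_diag A).
    by apply/rowP => l; rewrite !mxE mulNr.
  by rewrite trmxCK /hermfun -/P dE.
rewrite trmxCK [in LHS]AE scalemxAl scalemxAr; congr (_ *m _ *m _).
rewrite -linearZ/=; congr diag_mx; apply/rowP => l.
by rewrite !mxE rmorphM.
Qed.

Lemma measurable_normc_hermfun_expR (D : set (measurableTypeR R)) (i j : 'I_n) :
  measurable_fun D (fun t : measurableTypeR R =>
    (Normc.normc (hermfun expR ((- t)%:C *: A) i j))%:E).
Proof.
apply/measurable_EFinP.
pose S (u : R[i]) (t : R) :=
  \sum_l complex.Re (u * ((P l i)^* * P l j)) * expR (- (t * lam l)).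
(* The modulus is rebuilt from Re z and Im z = Re(-i z), each a finite sum of exponentials in t. *)
have -> : (fun t : R => Normc.normc (hermfun expR ((- t)%:C *: A) i j)) =
    (fun t => Num.sqrt (S 1 t ^+ 2 + S (- 'i) t ^+ 2)).
  apply/funext => t; rewrite hermfun_expR_scale.
  have SE u : S u t = complex.Re (u * hermfun (fun x => expR (- (t * x))) A i j).
    by rewrite Re_hermfun.
  rewrite !SE; case: (hermfun _ A i j) => x y /=.
  by congr (Num.sqrt (_ ^+ 2 + _ ^+ 2)); ring.
have mS u : measurable_fun D (S u : measurableTypeR R -> R).
  by apply: measurable_sum => l; apply: measurable_funM => //; exact: measurable_expR_scale.
apply: (measurableT_comp (continuous_measurable_fun (@sqrt_continuous R))).
by apply: measurable_funD; exact: measurable_funX.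
Qed.

Lemma spectral_row (l : 'I_n) : row l P *m A = (lam l)%:C *: row l P.
Proof.
rewrite -row_mul [in LHS]AE !mulmxA (unitarymxP Pu) mul1mx.
by apply/rowP => k; rewrite mul_diag_mx !mxE.
Qed.

Lemma spectral_ge0 (l : 'I_n) : 0 <= lam l.
Proof.
pose x : 'cV[R[i]]_n := (row l P)^t*.
have [_ /(_ x)] := A_psd.
have -> : x^t* = row l P.
  by apply/rowP => k; rewrite !mxE conjCK.
rewrite spectral_row -scalemxAl mxE.
have -> : (row l P *m x) 0 0 = 1.
  have /matrixP/(_ l l) := unitarymxP Pu; rewrite !mxE eqxx => PPll.
  by rewrite -[RHS]PPll; apply: eq_bigr => k _; rewrite !mxE.
by rewrite mulr1 ler0c.
Qed.

Lemma spectral_le_radius (l : 'I_n) : lam l <= spectral_radius A.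
Proof.
apply: sup_ubound.
  (* The supremum is an upper bound once the set is bounded. Every eigenvalue is some [lam k], seen
     at a nonzero coordinate of v P^*, and nonnegativity puts it below the sum of all of them. *)
  exists (\sum_k lam k) => _ [a /eigenvalueP[v vA v0] <-].
  have [k vk0] : exists k, (v *m P^t*) 0 k != 0.
    apply/existsP; apply: contraNT v0; rewrite negb_exists => /forallP v0.
    have : v *m P^t* = 0.
      by apply/rowP => k; rewrite [RHS]mxE; apply/eqP; rewrite -[_ == _]negbK v0.
    by move=> /(congr1 (mulmx^~ P)); rewrite -mulmxA PtP mulmx1 mul0mx => ->.
  have vD : v *m P^t* *m diag_mx (map_mx (real_complex R) (\row_l lam l)) =
      a *: (v *m P^t*).
    by rewrite scalemxAl -vA [in RHS]AE !mulmxA -[RHS]mulmxA (unitarymxP Pu) mulmx1.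
  have /rowP/(_ k) := vD; rewrite mul_mx_diag mxE [RHS]mxE mulrC.
  move=> /(mulIf vk0) <-; rewrite !mxE.
  rewrite /= expr0n addr0 sqrtr_sqr ger0_norm ?spectral_ge0//.
  rewrite (bigD1 k)//= lerDl sumr_ge0// => m _; exact: spectral_ge0.
exists (lam l)%:C => /=.
  apply/eigenvalueP; exists (row l P); first exact: spectral_row.
  apply/eqP => rP0; have : (row l P *m P^t*) 0 l = 1.
    by rewrite -row_mul (unitarymxP Pu) !mxE eqxx.
  by rewrite rP0 mul0mx mxE => /eqP; rewrite eq_sym oner_eq0.
by rewrite expr0n addr0 sqrtr_sqr ger0_norm// spectral_ge0.
Qed.

(** Expanding A^(m+1) = A A^m, a nonzero entry needs a nonzero product A_ik (A^m)_kj. A diagonal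
    factor k = i is no edge of the graph, so the walk may be shorter than m. *)
Lemma hermfun_exp_walk (m : nat) (i j : 'I_n) :
  hermfun (fun x => x ^+ m) A i j != 0 -> exists2 k, (k <= m)%N & has_walk A i j k.
Proof.
elim: m i => [|m IH] i.
  have -> : hermfun (fun x => x ^+ 0) A = 1%:M.
    have dE : map_mx (fun l : R[i] => (complex.Re l ^+ 0)%:C) (spectral_diag A) =
        const_mx 1.
      by apply/rowP => l; rewrite !mxE expr0.
    by rewrite /hermfun dE diag_const_mx mulmx1 PtP.
  rewrite mxE; have [->|] := eqVneq i j; last by rewrite eqxx.
  by move=> _; exists 0%N => //; apply/existsP; exists [tuple] => /=.
have -> : hermfun (fun x => x ^+ m.+1) A = A *m hermfun (fun x => x ^+ m) A.
  have PXYP (X Y : 'M[R[i]]_n) :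
      P^t* *m X *m P *m (P^t* *m Y *m P) = P^t* *m (X *m Y) *m P.
    by rewrite !mulmxA -[X in X *m Y]mulmxA (unitarymxP Pu) mulmx1.
  pose D q := diag_mx (map_mx (fun l : R[i] => (complex.Re l ^+ q)%:C) (spectral_diag A)).
  have DS : diag_mx (map_mx (real_complex R) (\row_l lam l)) *m D m = D m.+1.
    apply/matrixP => k l; rewrite mul_diag_mx !mxE exprS rmorphM.
    by rewrite mulrnAr.
  have := PXYP (diag_mx (map_mx (real_complex R) (\row_l lam l))) (D m).
  by rewrite -AE DS => ->.
rewrite mxE => /eqP s0.
have [k /andP[Aik kj]] : exists k, (A i k != 0) && (hermfun (fun x => x ^+ m) A k j != 0).
  apply/existsP; apply: contra_notT s0; rewrite negb_exists => /forallP s0.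
  apply: big1 => k _; apply/eqP; rewrite mulf_eq0.
  by move: (s0 k); rewrite negb_and !negbK.
have [q qm /existsP[p /andP[pp pl]]] := IH k kj.
have [ik|ik] := eqVneq i k.
  by exists q; [exact: leqW|apply/existsP; exists p; rewrite ik pp].
exists q.+1 => //; apply/existsP; exists [tuple of k :: p] => /=.
by rewrite /graph_adj/= ik Aik pp.
Qed.

End hermitian_entries.

(** * Splitting the integral and assembling the estimate *)

Lemma le_integral_three_ranges (R : realType)
    (mu : {measure set (measurableTypeR R) -> \bar R})
    (p q : R) (g g1 g2 g3 : measurableTypeR R -> R) :
  0 <= p -> p <= q ->
  measurable_fun (`]0%R, +oo[%classic : set (measurableTypeR R)) (EFin \o g) ->
  measurable_fun (`]0%R, p]%classic : set (measurableTypeR R)) (EFin \o g1) ->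
  measurable_fun (`]p, q]%classic : set (measurableTypeR R)) (EFin \o g2) ->
  measurable_fun (`]q, +oo[%classic : set (measurableTypeR R)) (EFin \o g3) ->
  (forall t : R, 0 <= g t) ->
  (forall t : R, 0 < t <= p -> g t <= 10 * g1 t) ->
  (forall t : R, p < t <= q -> g t <= 10 * g2 t) ->
  (forall t : R, q < t -> g t <= g3 t) ->
  (\int[mu]_(t in `]0%R, +oo[) (g t)%:E <=
     10%:E * \int[mu]_(t in `]0%R, p]) (g1 t)%:E
     + 10%:E * \int[mu]_(t in `]p, q]) (g2 t)%:E
     + \int[mu]_(t in `]q, +oo[) (g3 t)%:E)%E.
Proof.
move=> p0 pq mg mg1 mg2 mg3 g0 gg1 gg2 gg3.
pose D1 : set (measurableTypeR R) := `]0%R, p]%classic.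
pose D2 : set (measurableTypeR R) := `]p, q]%classic.
pose D3 : set (measurableTypeR R) := `]q, +oo[%classic.
have mD1 : measurable D1 by exact: measurable_itv.
have mD2 : measurable D2 by exact: measurable_itv.
have mD3 : measurable D3 by exact: measurable_itv.
have DE : `]0%R, +oo[%classic = D1 `|` D2 `|` D3.
  apply/seteqP; split => t; rewrite /D1 /D2 /D3 /= !in_itv/= !andbT.
    move=> t0; have [tp|pt] := leP t p; first by left; left; rewrite t0.
    by have [tq|qt] := leP t q; [left; right|right].
  by move=> [[/andP[]//|/andP[pt _]]|qt];
    [exact: le_lt_trans pt|exact: le_lt_trans (le_trans p0 pq) qt].
rewrite DE in mg *.
have mg12 : measurable_fun (D1 `|` D2) (EFin \o g).
  apply: measurable_funS mg => [|t]; last by left.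
  by do 2 apply: measurableU => //.
have g0' (D : set R) x : D x -> (0 <= (g x)%:E)%E by rewrite lee_fin.
rewrite ge0_integral_setU//; first last.
- apply/disj_setPS => t; rewrite /D1 /D2 /D3 /= !in_itv/= !andbT.
  move=> [[/andP[_ tp]|/andP[_ tq]] qt]; last by move: qt; rewrite ltNge tq.
  by move: qt; rewrite ltNge (le_trans tp).
- by move=> x; exact: g0'.
- exact: measurableU.
rewrite ge0_integral_setU//; first last.
- apply/disj_setPS => t; rewrite /D1 /D2 /= !in_itv/=.
  by move=> [/andP[_ tp] /andP[pt _]]; move: pt; rewrite ltNge tp.
- by move=> x; exact: g0'.
have D1p t : D1 t -> 0 < t <= p by rewrite /D1/= in_itv.
have D2p t : D2 t -> p < t <= q by rewrite /D2/= in_itv.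
have D3p t : D3 t -> q < t by rewrite /D3/= in_itv/= andbT.
(* Nonnegativity of the majorants comes for free from 0 <= g <= 10 g1 and 0 <= g <= 10 g2. *)
have g1_0 t : D1 t -> 0 <= g1 t by move=> /D1p/gg1; have := g0 t; lra.
have g2_0 t : D2 t -> 0 <= g2 t by move=> /D2p/gg2; have := g0 t; lra.
apply: leeD; first apply: leeD.
- apply: (@le_trans _ _ (\int[mu]_(t in D1) (10%:E * (g1 t)%:E))%E); last first.
    by rewrite ge0_integralZl_EFin// => t /g1_0; rewrite lee_fin.
  apply: ge0_le_integral => //.
  + by move=> t; exact: g0'.
  + by apply: measurable_funS mg12 => [|t]; [exact: measurableU|left].
  + exact: measurable_funeM.
- apply: (@le_trans _ _ (\int[mu]_(t in D2) (10%:E * (g2 t)%:E))%E); last first.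
    by rewrite ge0_integralZl_EFin// => t /g2_0; rewrite lee_fin.
  apply: ge0_le_integral => //.
  + by move=> t; exact: g0'.
  + by apply: measurable_funS mg12 => [|t]; [exact: measurableU|right].
  + exact: measurable_funeM.
- apply: ge0_le_integral => //.
  + by move=> t; exact: g0'.
  + apply: measurable_funS mg => [|t]; last by right.
    by do 2 apply: measurableU => //.
  + by move=> t /D3p/gg3; rewrite lee_fin.
Qed.

Lemma measurable_fun_inv_gt0 (R : realType) (D : set (measurableTypeR R)) :
  D `<=` `]0%R, +oo[%classic ->
  measurable_fun D (fun t : measurableTypeR R => t^-1 : R).
Proof.
move=> D0; apply: (measurable_funS _ D0); first exact: measurable_itv.
apply: (@open_continuous_measurable_fun R) => //.
move=> x; rewrite inE/= in_itv/= andbT => x0.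
by apply: inv_continuous; rewrite gt_eqF.
Qed.

Theorem lemma3p2 (R : realType) (n : nat) (f : R -> R) (a b : R)
    (mu : {measure set (measurableTypeR R) -> \bar R}) (A : 'M[R[i]]_n)
    (i j : 'I_n)
    (f_bernstein : bernstein f)
    (f_ext0 : f z @[z --> 0^'+] --> f 0)
    (f_levy : levy_khintchine f a b mu)
    (A_psd : psdmx A) :
  let rho := spectral_radius A in
  match geodist A i j with
  | Some d => (2 <= d)%N ->
      ((Normc.normc (hermfun f A i j))%:E <=
         10%:E * \int[mu]_(t in `]0%R, (2 * d%:R / rho)%R])
           (4 * expR (- (1 / 4 * rho * t)) / (rho * t)
            * (expR 1 * rho * t / (4 * d%:R)) ^+ d)%:E
       + 10%:E * \int[mu]_(t in `](2 * d%:R / rho)%R, (d%:R ^+ 2 / rho)%R])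
           (expR (- (4 * d%:R ^+ 2 / (5 * rho * t))))%:E
       + \int[mu]_(t in `](d%:R ^+ 2 / rho)%R, +oo[)
           (Normc.normc (hermfun expR ((- t)%:C *: A) i j))%:E)%E
  | None => (* d(i,j) = oo, the right-hand side is 0 *)
      Normc.normc (hermfun f A i j) <= 0
  end.
Proof.
move=> rho.
pose lam (l : 'I_n) : R := complex.Re (spectral_diag A 0 l).
have [r [r1 rf rh]] : exists r : 'I_n -> R, [/\ \sum_l `|r l| <= 1,
    Normc.normc (hermfun f A i j) = \sum_l r l * f (lam l)
  & forall h, `|\sum_l r l * h (lam l)| <= Normc.normc (hermfun h A i j)].
  exact: hermfun_entry_combination.
have lamB l : 0 <= lam l <= rho by rewrite spectral_ge0//= spectral_le_radius.
have lam0 l : 0 <= lam l by have /andP[] := lamB l.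
have rho0 : 0 <= rho by have /andP[l0 /(le_trans l0)] := lamB i.
pose g (t : measurableTypeR R) := `|\sum_l r l * expR (- (t * lam l))|.
have mg D : measurable_fun D g.
  apply: measurableT_comp => //; apply: measurable_sum => l.
  by apply: measurable_funM => //; exact: measurable_expR_scale.
(* Without walks of length at most m the entry (A^m)_ij is zero, and it dominates the m-th
   moment. *)
have rpow m : (forall k, (k <= m)%N -> ~~ has_walk A i j k) ->
    \sum_l r l * lam l ^+ m = 0.
  move=> nowalk; apply/eqP; rewrite -normr_le0.
  apply: le_trans (rh (fun x => x ^+ m)) _.
  have [->|/(hermfun_exp_walk A_psd)[k km]] :=
    eqVneq (hermfun (fun x => x ^+ m) A i j) 0; first by rewrite Normc.normc0.
  by rewrite (negbTE (nowalk _ km)).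
have H01 (m0 : \sum_l r l * lam l ^+ 0 = 0) (m1 : \sum_l r l * lam l ^+ 1 = 0) :
    ((Normc.normc (hermfun f A i j))%:E <= \int[mu]_(t in `]0%R, +oo[) (g t)%:E)%E.
  rewrite rf; apply: (levy_sum_le f_levy f_ext0) => //.
  by rewrite -[RHS]m0; apply: eq_bigr => l _; rewrite mulr1.
rewrite /geodist; case: pselect => [walk|nowalk]; last first.
  have r0 m : \sum_l r l * lam l ^+ m = 0.
    by apply: rpow => k _; apply/negP => ?; apply: nowalk; exists k.
  rewrite -lee_fin; apply: le_trans (H01 (r0 _) (r0 _)) _.
  rewrite le_eqVlt; apply/orP; left; apply/eqP; apply: integral0_eq => t.
  rewrite /= in_itv/= andbT => t0; congr EFin; apply/eqP.
  rewrite -normr_le0 /g normr_id.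
  (* At infinite distance all moments vanish, so the series bound holds with K = C = 0 and the
     integrand is zero. *)
  have := @sum_expR_bound _ _ r lam t 0 0 (ltW t0) (lexx _) (lexx _).
  by rewrite mul0r; apply => m; rewrite r0 normr0 mul0r.
case: ex_minnP => d _ dmin d2.
have r0 m : (m < d)%N -> \sum_l r l * lam l ^+ m = 0.
  move=> md; apply: rpow => k km; apply/negP => /dmin dk.
  by move: (leq_ltn_trans (leq_trans dk km) md); rewrite ltnn.
apply: le_trans (H01 (r0 _ _) (r0 _ _)) _ => //; first exact: leq_trans d2.
have d2R : 2 <= d%:R :> R by rewrite ler_nat.
have pq : 2 * d%:R / rho <= d%:R ^+ 2 / rho.
  by rewrite ler_wpM2r ?invr_ge0// expr2 ler_wpM2r.
have p0 : 0 <= 2 * d%:R / rho by rewrite divr_ge0// mulr_ge0.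
(* If rho = 0, then division by 0 yields 0, both break points are 0 and the first two ranges are
   empty. A point t in one of them therefore forces rho > 0. *)
have rho_gt0 : 2 * d%:R / rho != 0 \/ 2 * d%:R / rho != d%:R ^+ 2 / rho -> 0 < rho.
  move=> h; rewrite lt_neqAle rho0 andbT eq_sym; apply/eqP => rho_eq0.
  by move: h; rewrite rho_eq0 invr0 !mulr0 eqxx; case.
have minv (D : set (measurableTypeR R)) c : D `<=` `]0%R, +oo[%classic ->
    measurable_fun D (fun t : measurableTypeR R => (c * t)^-1 : R).
  move=> D0; have -> : (fun t : R => (c * t)^-1) = (fun t => c^-1 * t^-1).
    by apply/funext => t; rewrite invfM.
  by apply: measurable_funM => //; exact: measurable_fun_inv_gt0.
apply: le_integral_three_ranges => //.
- exact/measurable_EFinP.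
- apply/measurable_EFinP; apply: measurable_funM; last first.
    by apply: measurable_funX; apply: measurable_funM => //; exact: measurable_funM.
  apply: measurable_funM; last first.
    by apply: minv => t/=; rewrite !in_itv/= andbT => /andP[].
  apply: measurable_funM => //; apply: measurableT_comp => //.
  by apply: measurableT_comp => //; exact: measurable_funM.
- apply/measurable_EFinP; apply: measurableT_comp => //.
  apply: measurableT_comp => //; apply: measurable_funM => //.
  apply: minv => t/=; rewrite !in_itv/= andbT => /andP[+ _]; exact: le_lt_trans.
- exact: measurable_normc_hermfun_expR.
- by move=> t; exact: normr_ge0.
- move=> t td; apply: (sum_expR_decay_small td _ r1 lamB r0).
  by apply: rho_gt0; left; rewrite gt_eqF//; case/andP: td; exact: lt_le_trans.
- move=> t /andP[pt tq]; apply: (sum_expR_decay_mid pt _ r1 lamB r0).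
  by apply: rho_gt0; right; rewrite lt_eqF// (lt_le_trans pt).
- by move=> t _; rewrite hermfun_expR_scale//; exact: rh.
Qed.
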